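(* Let $G$ be a connected simple graph on $n\ge 5$ vertices with minimum degree $\delta(G)\ge 2$. If \[ \mu(G) \ge \sqrt{n^2-6n+15}, \] then $G$ is pancyclic unless $G$ is bipartite.
   Context: All graphs are finite, simple and undirected. $\mu(G)$ denotes the spectral radius of $G$, i.e., the largest eigenvalue of its adjacency matrix. A graph on $n$ vertices is pancyclic if it contains a cycle of every length $l$ with $3\le l\le n$. *)

(* Defs.v *)
From mathcomp Require Import all_boot all_order all_algebra.
From mathcomp Require Import complex polyrcf.

Set Implicit Arguments.
Unset Strict Implicit.
Unset Printing Implicit Defensive.

Import Order.TTheory GRing.Theory Num.Theory.
Local Open Scope ring_scope.

(* A simple graph on the vertex set T is an adjacency relation e : rel T that *)
(* is symmetric and irreflexive.                                              *)

Definition connected_graph (T : finType) (e : rel T) : Prop :=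
  forall x y : T, connect e x y.

Definition deg (T : finType) (e : rel T) (x : T) : nat := #|[set y | e x y]|.

(* Every degree is at most #|T|, so the default value #|T| does not affect    *)
(* the minimum when T is nonempty.                                            *)
Definition min_degree (T : finType) (e : rel T) : nat :=
  \big[minn/#|T|]_(x : T) deg e x.

Definition bipartite (T : finType) (e : rel T) : Prop :=
  exists side : T -> bool, forall x y : T, e x y -> side x != side y.

(* For l >= 3, a duplicate-free e-cycle of size l in the sense of path.v is   *)
(* exactly a cycle of length l of the graph.                                  *)
Definition has_cycle (T : finType) (e : rel T) (l : nat) : Prop :=
  exists c : seq T, ucycle e c /\ size c = l.

Definition pancyclic (T : finType) (e : rel T) : Prop :=
  forall l : nat, (3 <= l <= #|T|)%N -> has_cycle e l.

Definition adjmx (R : nzRingType) (T : finType) (e : rel T) : 'M[R]_#|T| :=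
  \matrix_(i, j) (e (enum_val i) (enum_val j))%:R.

Definition is_spectral_radius (R : realFieldType) (T : finType) (e : rel T)
    (mu : R) : Prop :=
  eigenvalue (adjmx R e) mu /\
  forall a : R, eigenvalue (adjmx R e) a -> a <= mu.

Lemma is_spectral_radius_uniq (R : realFieldType) (T : finType) (e : rel T)
    (mu nu : R) :
  is_spectral_radius e mu -> is_spectral_radius e nu -> mu = nu.
Proof.
move=> [emu mumax] [enu numax].
by apply/eqP; rewrite eq_le numax // mumax.
Qed.

Lemma adjmx_has_eigenvalue (R : rcfType) (T : finType) (e : rel T) :
  symmetric e -> (0 < #|T|)%N -> exists a : R, eigenvalue (adjmx R e) a.
Proof.
move=> esym n_gt0; set A := adjmx R e.
pose f := real_complex R.
have [z zroot] : exists z, root (char_poly (map_mx f A)) z.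
  apply: closed_rootP; rewrite size_char_poly.
  by case: #|T| n_gt0.
have /eigenvalueP[v vA v0] : eigenvalue (map_mx f A) z.
  by rewrite eigenvalue_root_char.
pose w := map_mx Num.conj v.
have AT : (map_mx f A)^T = map_mx f A.
  by apply/matrixP=> i j; rewrite !mxE esym.
have wA : w *m map_mx f A = z^* *: w.
  have -> : map_mx f A = map_mx Num.conj (map_mx f A).
    apply/matrixP=> i j; rewrite !mxE.
    by case: (e _ _); rewrite ?rmorph1 ?rmorph0.
  by rewrite -map_mxM vA map_mxZ.
have Aw : map_mx f A *m w^T = z^* *: w^T.
  by rewrite -{1}AT -trmx_mul wA linearZ.
have vw0 : (v *m w^T) 0 0 != 0.
  rewrite mxE; apply: contra v0 => /eqP s0.
  apply/eqP/rowP=> i; rewrite mxE.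
  have /psumr_eq0P H : forall j, true -> 0 <= v 0 j * (v 0 j)^*.
    by move=> j _; exact: mul_conjC_ge0.
  apply/eqP; rewrite -mul_conjC_eq0; apply/eqP.
  apply: H => //; rewrite -[RHS]s0; apply: eq_bigr => j _.
  by rewrite !mxE.
have zreal : z = z^*.
  have : (v *m map_mx f A *m w^T) 0 0 = (v *m (map_mx f A *m w^T)) 0 0.
    by rewrite mulmxA.
  by rewrite vA Aw -scalemxAl -scalemxAr [LHS]mxE [RHS]mxE => /(mulIf vw0).
have [a za] : exists a, z = f a.
  exists (complex.Re z).
  have : z \is Num.real by rewrite CrealE -zreal.
  by move=> /complex_realP[x ->].
exists a; rewrite eigenvalue_root_char.
by move: zroot; rewrite za -map_char_poly fmorph_root.
Qed.

Lemma is_spectral_radius_exists (R : rcfType) (T : finType) (e : rel T) :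
  symmetric e -> (0 < #|T|)%N -> exists mu : R, is_spectral_radius e mu.
Proof.
move=> esym n_gt0; have [a0 ea0] := adjmx_has_eigenvalue R esym n_gt0.
pose p := char_poly (adjmx R e).
have p0 : p != 0 by rewrite monic_neq0 ?char_poly_monic.
have rootsE a : (a \in rootsR p) = eigenvalue (adjmx R e) a.
  by rewrite -(roots_on_rootsR p0) eigenvalue_root_char.
have max_seq (s : seq R) x : exists2 m, m \in x :: s & {in x :: s, forall b, b <= m}.
  elim: s x => [|y s IHs] x.
    by exists x => [|b]; rewrite inE // => /eqP->.
  have [m ms mmax] := IHs y; have [xm|mx] := leP x m.
    exists m; first by rewrite inE ms orbT.
    by move=> b; rewrite inE => /predU1P[->|/mmax].
  exists x; first exact: mem_head.
  by move=> b; rewrite inE => /predU1P[->|/mmax/le_trans->] //; exact: ltW.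
move: ea0; rewrite -rootsE; case: (rootsR p) rootsE => // x s rE _.
have [m ms mmax] := max_seq s x.
by exists m; split=> [|a]; rewrite -rE // => /mmax.
Qed.

(* Main.v *)
(** Let n be the order of the graph, D the sum of the degrees and d a lower bound
    on the degrees.  If v is an eigenvector for mu, then u = |v| satisfies
    mu u <= A u, and pairing A^2 1 <= (D - d (n - 1)) 1 + (d - 1) A 1 with u gives
    mu (mu - d + 1) <= D - d (n - 1).  The hypothesis on mu therefore forces
    D > n^2 - 5 n + 14, with slightly more when n >= 7 or d >= 3.

    Adding an edge between two nonadjacent vertices whose degrees sum to at least
    n does not affect hamiltonicity (Bondy and Chvatal).  When no such pair is
    left and the graph is not complete, a nonadjacent pair with the largest
    degree sum, the smaller degree being k < n / 2, gives
    D <= (n - k)(n - k - 1) + 2 k^2, against the lower bound on D.  So the graph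
    is hamiltonian.

    Finally 2 D > n^2, so two consecutive vertices of a Hamilton cycle have
    degree sum larger than n, and pairing their possible chords yields a cycle of
    each length (Bondy). *)

Require Import Defs.
From mathcomp Require Import all_boot all_order all_algebra.
From mathcomp Require Import reals.
From mathcomp Require Import zify lra.

Import Order.TTheory GRing.Theory Num.Theory.
Local Open Scope nat_scope.

(** * Degree counts, and cycles closed by two chords of a path *)

Lemma degE (T : finType) (e : rel T) x : deg e x = \sum_y e x y.
Proof.
rewrite /deg cardsE -sum1_card big_mkcond; apply: eq_bigr => y _.
by rewrite unfold_in; case: (e x y).
Qed.

Lemma spanning_mem (T : finType) (c : seq T) :
  uniq c -> size c = #|T| -> c =i T.
Proof.
by move=> Uc sc; apply/subset_cardP; [rewrite (card_uniqP Uc) | apply/subsetP].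
Qed.

Lemma deg_nth (T : finType) (e : rel T) (c : seq T) x0 x :
  uniq c -> size c = #|T| ->
  deg e x = \sum_(0 <= i < #|T|) e x (nth x0 c i).
Proof.
move=> Uc sc.
rewrite degE -sc -(big_nth x0 xpredT (fun y => nat_of_bool (e x y))).
by rewrite [RHS]big_uniq //=; apply: eq_bigl => y; rewrite spanning_mem.
Qed.

(** Pigeonhole: if [a k] and [b (k + d)] never held together, each of the [j - i] indices would
    contribute at most one to the two sums. *)
Lemma sum_shift_meet (a b : nat -> bool) i j d :
  i <= j ->
  j - i < \sum_(i <= k < j) a k + \sum_(i + d <= k < j + d) b k ->
  exists k, [/\ i <= k < j, a k & b (k + d)].
Proof.
move=> lij.
have [|/hasPn ab] := boolP (has (fun k => a k && b (k + d)) (index_iota i j)).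
  by case/hasP=> k; rewrite mem_index_iota => ikj /andP[]; exists k.
rewrite ltnNge -[X in _ <= X]muln1 -sum_nat_const_nat => /negP[].
rewrite (big_addn i _ d) addnK -big_split /= big_nat [X in _ <= X]big_nat.
apply: leq_sum => k; rewrite -mem_index_iota => /ab.
by case: (a k); case: (b _).
Qed.

(* The cycle is x_0 .. x_i x_m .. x_j, where x :: p is x_0 .. x_m. *)
Lemma crossing_cycle (T : finType) (e : rel T) (x : T) p i j :
  symmetric e ->
  path e x p -> uniq (x :: p) -> i < j <= size p ->
  e x (nth x (x :: p) j) -> e (last x p) (nth x (x :: p) i) ->
  has_cycle e (i + (size p - j)).+2.
Proof.
set c := x :: p => e_sym xp Uc /andP[ij jp] exj exi.
exists (take i.+1 c ++ rev (drop j c)); split; last first.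
  by rewrite size_cat size_rev size_drop size_takel /c /=; lia.
apply/andP; split; last first.
  rewrite (perm_uniq (s2 := take i.+1 c ++ drop j c)); last first.
    by rewrite perm_cat2l perm_rev.
  apply: subseq_uniq Uc; rewrite -{3}(cat_take_drop i.+1 c) cat_subseq //.
  by rewrite -(subnK ij) -drop_drop drop_subseq.
have dropE : drop j c = nth x c j :: drop j p by rewrite (drop_nth x).
have xtake : path e x (take i p) by exact: take_path.
have ltake : last x (take i p) = nth x c i.
  rewrite (last_nth x) size_takel; last by lia.
  by case: (i) => //= k; rewrite nth_take.
have pdrop : path e (nth x c j) (drop j p).
  by have /(drop_sorted j) : sorted e c by []; rewrite dropE.
have ldrop : last (nth x c j) (drop j p) = last x p.
  by have := congr1 (last x) (cat_take_drop j c); rewrite last_cat dropE.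
rewrite /c /= -/c rcons_cat cat_path xtake ltake dropE.
rewrite {1}lastI rev_rcons /= e_sym ldrop exi rcons_path -ldrop rev_path.
rewrite (eq_path (e' := e)) ?pdrop /=; last by move=> ? ?; rewrite e_sym.
have -> : last (last (nth x c j) (drop j p))
    (rev (belast (nth x c j) (drop j p))) = nth x c j.
  have := congr1 (last x) (rev_cons (nth x c j) (drop j p)).
  by rewrite last_rcons lastI rev_rcons.
by rewrite e_sym.
Qed.

(* The cycle is x_0 x_i .. x_j x_m, where x :: p is x_0 .. x_m. *)
Lemma chord_cycle (T : finType) (e : rel T) (x : T) p i j :
  symmetric e ->
  path e x p -> uniq (x :: p) -> 0 < i <= j -> j < size p ->
  e (last x p) x ->
  e x (nth x (x :: p) i) -> e (last x p) (nth x (x :: p) j) ->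
  has_cycle e (j - i).+3.
Proof.
set c := x :: p => e_sym xp Uc /andP[i0 ij] jp elx exi exj.
pose q := take (j - i) (drop i p).
have takeE : take (j - i).+1 (drop i c) = nth x c i :: q.
  by rewrite (drop_nth x) //= ltnS; lia.
have lq : last (nth x c i) q = nth x c j.
  rewrite /q (last_nth x) size_takel ?size_drop; last lia.
  by rewrite -takeE nth_take // nth_drop subnKC.
have pq : path e (nth x c i) q.
  have /(drop_sorted i)/(take_sorted (j - i).+1) : sorted e c by [].
  by rewrite takeE.
exists (x :: rcons (nth x c i :: q) (last x p)); split; last first.
  by rewrite /= size_rcons /q size_takel // size_drop; lia.
apply/andP; split.
  by rewrite /= exi !rcons_path pq lq e_sym exj last_rcons elx.
apply: subseq_uniq Uc.
rewrite -{2}(cat_take_drop i c) -(cat_take_drop (j - i).+1 (drop i c)) takeE.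
rewrite -cat1s -cats1 cat_subseq //.
  by rewrite sub1seq; case: (i) i0 => //= k _; rewrite mem_head.
rewrite cat_subseq // sub1seq drop_drop.
have -> : last x p = last x (drop ((j - i).+1 + i) c).
  rewrite -{1}[last x p]/(last x c) -{1}(cat_take_drop ((j - i).+1 + i) c).
  rewrite last_cat.
  rewrite (drop_nth x) //= ltnS; lia.
by rewrite (drop_nth x) //= ?mem_last // ltnS; lia.
Qed.

(** * Ore's crossing argument and the Bondy-Chvatal closure *)

(** Pigeonhole with shift 1 finds consecutive path vertices, the first adjacent to the end of the
    path and the second to its start; the crossing cycle then omits no vertex. *)
Lemma ore_crossing (T : finType) (e : rel T) (x : T) p :
  symmetric e -> irreflexive e ->
  path e x p -> uniq (x :: p) -> size (x :: p) = #|T| ->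
  #|T| <= deg e x + deg e (last x p) -> has_cycle e #|T|.
Proof.
move=> e_sym e_irr xp Uc sc.
rewrite (deg_nth _ _ _ x x Uc sc) (deg_nth _ _ _ x (last x p) Uc sc) -sc.
rewrite [size _]/= big_nat_recl // [X in _ + X]big_nat_recr //= nth_last /=.
rewrite !e_irr add0n addn0 addnC => ltn.
have [||k []] := @sum_shift_meet (fun i => e (last x p) (nth x (x :: p) i))
  (fun i => e x (nth x (x :: p) i)) 0 (size p) 1 => //.
  rewrite subn0 (big_addn 0 _ 1) addnK.
  by under [X in _ < _ + X]eq_bigr do rewrite addn1.
move=> /andP[_ kp] ek exk.
have -> : (size p).+1 = (k + (size p - (k + 1))).+2 by lia.
by apply: crossing_cycle => //; lia.
Qed.

Definition add_edge (T : finType) (e : rel T) (u v : T) : rel T :=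
  [rel x y | [|| e x y, (x == u) && (y == v) | (x == v) && (y == u)]].

(** Rotate the cycle to start at [u], with cycle neighbours [a] and [b]. If one of them is [v],
    cutting the cycle there leaves a Hamilton path of [e] between [u] and [v], to which Ore's
    argument applies; otherwise the cycle already lies in [e]. *)
Lemma closure_step (T : finType) (e : rel T) (u v : T) :
  symmetric e -> irreflexive e -> 3 <= #|T| ->
  #|T| <= deg e u + deg e v ->
  has_cycle (add_edge T e u v) #|T| -> has_cycle e #|T|.
Proof.
move=> e_sym e_irr T3 duv [c [uc sc]].
have uc' : u \in c by rewrite spanning_mem //; case/andP: uc.
have [i p defc] := rot_to uc'.
move: uc; rewrite -(rot_ucycle i) defc => /andP[cE Uup].
have {sc} sp : size (u :: p) = #|T| by rewrite -defc size_rot.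
case: p {defc} cE Uup sp => [|a q].
  by move=> _ _ /= sp; rewrite -sp in T3.
case/lastP: q => [|q b]; first by move=> _ _ /= sp; rewrite -sp in T3.
move=> cE Uc sc.
have [ua ub ab upq] :
    [/\ a != u, b != u, a != b & all (predC1 u) (a :: rcons q b)].
  move: Uc; rewrite /= !inE !mem_rcons !inE !negb_or.
  case/andP=> [/and3P[ua ub uq] /andP[/andP[ab _] _]].
  rewrite /= all_rcons /= (eq_sym a u) (eq_sym b u) ua ub ab; split=> //=.
  by apply/allP=> z zq /=; apply: contraNneq uq => <-.
move: cE; rewrite /= rcons_path => /and3P[Eua Eab Ebu].
have eab : path e a (rcons q b).
  move: Eab; rewrite (@eq_in_path _ (predC1 u) _ e) // => x y /=.
  rewrite !inE => /negPf xu /negPf yu.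
  by rewrite /add_edge /= xu yu andbF !orbF.
rewrite last_rcons in Ebu.
have [av|av] := eqVneq a v.
  have ebu : e b u.
    rewrite eq_sym in ab; move: Ebu.
    by rewrite /add_edge /= (negPf ub) -av (negPf ab) !orbF.
  apply: (ore_crossing _ _ a (rcons (rcons q b) u)) => //.
  - by rewrite rcons_path eab last_rcons.
  - by rewrite -rcons_cons rcons_uniq.
  - by rewrite -sc /= !size_rcons.
  - by rewrite last_rcons addnC av.
have eua : e u a.
  by move: Eua; rewrite /add_edge /= (negPf ua) (negPf av) !andbF !orbF.
have [bv|bv] := eqVneq b v.
  apply: (ore_crossing _ _ u (a :: rcons q b)) => //=.
    by rewrite eua.
  by rewrite last_rcons bv.
exists (u :: a :: rcons q b); split=> //.
rewrite /ucycle Uc andbT /= eua rcons_path eab last_rcons.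
by move: Ebu; rewrite /add_edge /= (negPf ub) (negPf bv) !orbF.
Qed.

Lemma complete_hamiltonian (T : finType) (e : rel T) :
  (forall x y, x != y -> e x y) -> 3 <= #|T| -> has_cycle e #|T|.
Proof.
move=> eT T3; exists (enum T); rewrite -cardE; split=> //.
rewrite /ucycle enum_uniq andbT.
have := enum_uniq T; move: T3; rewrite cardE.
case: (enum T) => [//|x p] /=; case/lastP: p => [//|p y] _ /andP[xp Up].
rewrite rcons_path last_rcons eT; last first.
  by apply: contraNneq xp => <-; rewrite mem_rcons mem_head.
rewrite andbT; apply: (@pairwise_sorted _ _ (x :: rcons p y)).
have : uniq (x :: rcons p y) by rewrite /= xp.
by rewrite uniq_pairwise; apply: sub_pairwise => u v /= /eT.
Qed.

(** * Hamiltonicity from a large degree sum *)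

Lemma sum_eq1 (T : finType) (x : T) : \sum_y (y == x) = 1.
Proof. by rewrite (bigD1 x) //= eqxx big1 ?addn0 // => y /negPf->. Qed.

(* With k = deg u, so that n = 2 k + r + 1, the bound without the w0 term reads
   D <= (n - k)(n - k - 1) + 2 k^2.  For n = 7 and n = 9 this is one too weak,
   and a vertex w0 of degree below k supplies the missing unit. *)
Lemma stuck_degree_sum (T : finType) (e : rel T) (u v w0 : T) r :
  symmetric e -> irreflexive e -> u != v -> ~~ e u v ->
  deg e u <= deg e v ->
  deg e u + deg e v < #|T| ->
  (forall x y, x != y -> ~~ e x y -> deg e x + deg e y <= deg e u + deg e v) ->
  #|T| = (deg e u).*2 + r.+1 ->
  \sum_x deg e x + r * deg e u + (deg e u - deg e w0)
    <= #|T| * (deg e u + r) + deg e u * deg e u.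
Proof.
move=> e_sym e_irr uv nuv duv ltn maxuv defn.
set k := deg e u in duv ltn maxuv defn *.
(* By maximality of the pair, these non-neighbours of [v] have degree at most [k]; there are
   [#|T| - 1 - deg e v >= k] of them. *)
pose S w := (w != v) && ~~ e w v.
have cardS : k <= \sum_w S w.
  have : \sum_w S w + \sum_w e v w + \sum_w (w == v) = #|T|.
    rewrite -!big_split /= -sum1_card; apply: eq_bigr => w _.
    rewrite /S (e_sym w v); case: eqVneq => [->|_]; rewrite ?e_irr //.
    by case: (e v w).
  rewrite -degE sum_eq1; lia.
(* Non-neighbours of [u] have degree at most [k + r], the others at most [#|T| - 1 = k + r + k];
   members of [S] fall short by a further [r]. *)
have bound w :
    deg e w + r * S w + (w == w0) * (k - deg e w0) <= (k + r) + k * e u w.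
  have leS : S w -> deg e w <= k.
    by case/andP=> wv nwv; have := maxuv _ _ wv nwv; lia.
  have leu : ~~ e u w -> deg e w <= k + r.
    move=> nuw; case: (eqVneq u w) => [<-|uw]; first by rewrite leq_addr.
    have := maxuv _ _ uw nuw; lia.
  have ltT : deg e w < #|T|.
    rewrite /deg -cardsT; apply: proper_card.
    apply/properP; split; first exact: subsetT.
    by exists w; rewrite ?inE // e_irr.
  case: eqVneq => [<-|_]; case: (S w) leS => [/(_ isT)|_];
    case: (e u w) leu => [_|/(_ isT)] /=; lia.
have : \sum_w (deg e w + r * S w + (w == w0) * (k - deg e w0))
    <= \sum_w ((k + r) + k * e u w).
  exact: leq_sum.
rewrite !big_split /= -!big_distrr -big_distrl /= -degE !sum_nat_const -/k.
rewrite sum_eq1 mul1n mulnDr -[#|xpredT|]/#|T|.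
by apply: leq_trans; rewrite leq_add2r leq_add2l leq_mul.
Qed.

(** Excludes a closed graph with a vertex of degree 2. Tight by one: the last hypothesis gives
    [D + 5 n <= n^2 + 14] when [k = 2], and [n^2 + 15] when [k = 3], [n = 7]. *)
Lemma small_degree_arith k r D (n := k.*2 + r.+1) :
  2 <= k -> n ^ 2 + 15 <= D + 5 * n -> (7 <= n -> n ^ 2 + 16 <= D + 5 * n) ->
  D + r * k + (k - 2) <= n * (k + r) + k * k -> False.
Proof.
rewrite /n; case: k @n => [|[|[|[|k]]]] // n _ h15 h16; first by nia.
  have := h16 isT; nia.
nia.
Qed.

(** Excludes a closed graph of minimum degree at least 3. The constant 17 is tight: for [k = 3],
    [n = 7] and for [k = 4], [n = 9] the last hypothesis gives [D + 5 n <= n^2 + 16]. *)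
Lemma large_degree_arith k r D (n := k.*2 + r.+1) :
  3 <= k -> n ^ 2 + 17 <= D + 5 * n ->
  D + r * k <= n * (k + r) + k * k -> False.
Proof. by rewrite /n; case: k @n => [|[|[|[|[|k]]]]] // n _; nia. Qed.

Lemma dense_hamiltonian (T : finType) (e : rel T) :
  symmetric e -> irreflexive e -> 5 <= #|T| ->
  (forall x, 2 <= deg e x) ->
  #|T| ^ 2 + 15 <= \sum_x deg e x + 5 * #|T| ->
  (7 <= #|T| -> #|T| ^ 2 + 16 <= \sum_x deg e x + 5 * #|T|) ->
  (7 <= #|T| -> (forall x, 3 <= deg e x) ->
    #|T| ^ 2 + 17 <= \sum_x deg e x + 5 * #|T|) ->
  has_cycle e #|T|.
Proof.
have [m] := ubnP (#|T| ^ 2 - \sum_x deg e x).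
elim: m e => // m IHm e ltm e_sym e_irr n5 d2 h15 h16 h17.
have [|noP] := boolP [exists u, exists v,
    [&& u != v, ~~ e u v & #|T| <= deg e u + deg e v]].
  case/existsP=> u /existsP[v /and3P[uv nuv duv]].
  apply: (closure_step _ _ u v) => //; first by lia.
  have sub x y : e x y -> add_edge T e u v x y.
    by move=> exy; rewrite /add_edge /= exy.
  have dle x : deg e x <= deg (add_edge T e u v) x.
    by apply: subset_leq_card; apply/subsetP=> y; rewrite !inE; exact: sub.
  have dlt : deg e u < deg (add_edge T e u v) u.
    apply: proper_card; apply/properP; split.
      by apply/subsetP=> y; rewrite !inE; exact: sub.
    by exists v; rewrite !inE // /add_edge /= !eqxx orbT.
  have Dlt : \sum_x deg e x < \sum_x deg (add_edge T e u v) x.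
    rewrite (bigD1 u) // [X in _ < X](bigD1 u) //= -addSn leq_add //.
    by apply: leq_sum.
  have Dle : \sum_x deg (add_edge T e u v) x <= #|T| ^ 2.
    rewrite expnS expn1 -sum_nat_const.
    by apply: leq_sum => x _; exact: max_card.
  (* The new edge may raise the minimum degree to 3, where no bound with 17 was known for [e]; it
     follows from the bound with 16 because the degree sum has strictly grown. *)
  apply: IHm => //; try lia.
  - move=> x y; rewrite /add_edge /= e_sym; congr (_ || _).
    by rewrite orbC ![(x == _) && _]andbC.
  - move=> x; rewrite /add_edge /= e_irr /= andbC orbb.
    by apply/negP=> /andP[/eqP-> /eqP vu]; rewrite vu eqxx in uv.
  - by move=> x; apply: leq_trans (dle x).
have stuck u v : u != v -> ~~ e u v -> deg e u + deg e v < #|T|.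
  move=> uv nuv; rewrite ltnNge; apply/negP=> duv; case/negP: noP.
  by apply/existsP; exists u; apply/existsP; exists v; rewrite uv nuv.
pose P (z : T * T) := (z.1 != z.2) && ~~ e z.1 z.2.
case: (pickP P) => [z0 Pz0|noz]; last first.
  apply: complete_hamiltonian; last by lia.
  by move=> x y xy; have := noz (x, y); rewrite /P /= xy /= => /negbFE.
pose F (z : T * T) := deg e z.1 + deg e z.2.
case: (@arg_maxnP _ z0 P F Pz0) => [[u v] /= /andP[uv nuv] maxF].
wlog duv : u v uv nuv maxF / deg e u <= deg e v.
  move=> W; have [duv|/ltnW duv] := leqP (deg e u) (deg e v).
    exact: (W u v).
  apply: (W v u) => //; first by rewrite eq_sym.
    by rewrite e_sym.
  by move=> z /maxF; rewrite /F /= (addnC (deg e u)).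
rewrite /= in uv nuv.
have ltuv := stuck u v uv nuv.
have maxuv x y : x != y -> ~~ e x y -> deg e x + deg e y <= deg e u + deg e v.
  by move=> xy nxy; apply: (maxF (x, y)); rewrite /P /= xy nxy.
have [r defn] : exists r, #|T| = (deg e u).*2 + r.+1.
  by exists (#|T| - (deg e u).*2.+1); lia.
have bound w0 :=
  @stuck_degree_sum T e u v w0 r e_sym e_irr uv nuv duv ltuv maxuv defn.
have k2 := d2 u.
(* A vertex of degree 2 serves as [w0]; without one, all degrees are at least 3 and [h17] becomes
   available. *)
exfalso; have [/existsP[w0 /eqP dw0]|no2] := boolP [exists w, deg e w == 2].
  have := bound w0; rewrite dw0 defn; rewrite defn in h15 h16.
  exact: small_degree_arith k2 h15 h16.
have d3 x : 3 <= deg e x.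
  rewrite ltn_neqAle d2 eq_sym andbT; apply: contra no2 => dx.
  by apply/existsP; exists x.
have := leq_trans (leq_addr _ _) (bound u); have k3 := d3 u.
have h := h17 _ d3; rewrite defn in h *.
have n7 : 7 <= (deg e u).*2 + r.+1 by lia.
exact: large_degree_arith k3 (h n7).
Qed.

(** * Bondy's passage from a Hamilton cycle to all lengths *)

Lemma bondy_crossing (T : finType) (e : rel T) (x : T) (p : seq T) l :
  symmetric e -> irreflexive e ->
  path e x p -> uniq (x :: p) -> size (x :: p) = #|T| -> e (last x p) x ->
  #|T| < deg e x + deg e (last x p) -> 3 <= l <= #|T| -> has_cycle e l.
Proof.
move=> e_sym e_irr xp Uxp sp elx dx /andP[l3 ln].
rewrite (deg_nth _ _ _ x x Uxp sp) (deg_nth _ _ _ x (last x p) Uxp sp) in dx.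
set a := fun k => e x (nth x (x :: p) k).
set b := fun k => e (last x p) (nth x (x :: p) k).
have {sp} sp : #|T| = (size p).+1 by rewrite -sp.
have lp : l <= (size p).+1 by rewrite -sp.
have p2 : 1 < size p by lia.
have split3 (f : nat -> bool) : \sum_(0 <= k < #|T|) f k
    = f 0 + \sum_(1 <= k < size p) f k + f (size p).
  by rewrite sp big_nat_recr //= big_ltn // ltnW.
(* The closing edge, seen from both ends, accounts for at most 2 of the degree sum, so the chords to
   inner vertices outnumber those vertices. *)
have {dx} : size p - 1
    < \sum_(1 <= k < size p) a k + \sum_(1 <= k < size p) b k.
  have a0 : a 0 = false by rewrite /a /= e_irr.
  have bl : b (size p) = false.
    by rewrite /b -[size p]/(size (x :: p)).-1 nth_last /= e_irr.
  move: dx; rewrite (split3 a) (split3 b) a0 bl {1}sp.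
  case: (a (size p)); case: (b 0); lia.
(* The cuts produce [size p + 2 - l] pairs of one kind and [l - 3] of the other, [size p - 1] in
   all, so some pair has both its chords present. *)
rewrite (@big_cat_nat _ _ _ (size p + 3 - l) 1 (size p) xpredT
  (fun k => nat_of_bool (a k))) /=; [|lia..].
rewrite (@big_cat_nat _ _ _ (l - 2) 1 (size p) xpredT
  (fun k => nat_of_bool (b k))) /=; [|lia..].
move=> big.
(* Chords x x_k and x_m x_(k + l - 3) close a chord cycle of length l, while
   x_m x_k and x x_(k + m + 2 - l) close a crossing cycle of length l; here
   x :: p is x_0 .. x_m. *)
have [ltab|leab] := ltnP (size p + 3 - l - 1)
  (\sum_(1 <= k < size p + 3 - l) a k + \sum_(l - 2 <= k < size p) b k).
  have [||k [kl ak bk]] := @sum_shift_meet a b 1 (size p + 3 - l) (l - 3).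
  - lia.
  - have -> : 1 + (l - 3) = l - 2 by lia.
    by have -> : size p + 3 - l + (l - 3) = size p by lia.
  have -> : l = (k + (l - 3) - k).+3 by lia.
  by apply: chord_cycle ak bk => //; lia.
have [||k [kl bk ak]] := @sum_shift_meet b a 1 (l - 2) (size p + 2 - l).
- lia.
- have -> : 1 + (size p + 2 - l) = size p + 3 - l by lia.
  have -> : l - 2 + (size p + 2 - l) = size p by lia.
  lia.
have -> : l = (k + (size p - (k + (size p + 2 - l)))).+2 by lia.
by apply: crossing_cycle ak bk => //; lia.
Qed.

Lemma hamiltonian_pancyclic (T : finType) (e : rel T) :
  symmetric e -> irreflexive e ->
  #|T| ^ 2 < 2 * \sum_x deg e x ->
  has_cycle e #|T| -> pancyclic e.
Proof.
move=> e_sym e_irr dense [c [uc sc]] l lT.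
have Uc : uniq c by case/andP: uc.
(* Averaging: [prev c] permutes the vertices, so these sums add up to twice the degree sum. *)
have [x dx] : exists x, #|T| < deg e x + deg e (prev c x).
  apply/existsP; apply: contraLR dense; rewrite negb_exists => /forallP le.
  rewrite -leqNgt mul2n -addnn {2}(reindex_inj (can_inj (next_prev Uc))).
  rewrite -big_split /= expnS expn1 -sum_nat_const; apply: leq_sum => y _.
  by rewrite leqNgt.
have xc : x \in c by rewrite spanning_mem.
have [i p defc] := rot_to xc.
move: uc; rewrite -(rot_ucycle i) defc => /andP[cxp Uxp].
have prevE : prev c x = last x p.
  rewrite -(prev_rot i Uc) defc.
  have /= /andP[xNp _] := Uxp.
  have E y : prev_at x x y p = last y p.
    elim: p {defc cxp Uxp} y xNp => [|z p IHp] y /=; first by rewrite eqxx.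
    by rewrite inE negb_or => /andP[/negPf-> /IHp].
  exact: E.
have sp : size (x :: p) = #|T| by rewrite -defc size_rot.
move: cxp; rewrite /= rcons_path => /andP[xp elx].
by apply: bondy_crossing xp Uxp sp elx _ lT; rewrite -?prevE.
Qed.

(** * Spectral lower bound on the degree sum *)

(** The degree sum consists of the neighbours' degrees, [deg e y], and at least [d.+1] for each of
    the [#|T| - 1 - deg e y] remaining vertices. The lower bound on degrees is [d.+1], so [d] is one
    less than in the overview. *)
Lemma neighbor_degree_sum (T : finType) (e : rel T) d y :
  irreflexive e -> (forall x, d < deg e x) ->
  \sum_x e y x * deg e x + d.+1 * #|T|.-1 <= \sum_x deg e x + d * deg e y.
Proof.
move=> e_irr dmin.
have : \sum_x (e y x * deg e x + d.+1 * (x != y) + (x == y) * deg e y)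
     <= \sum_x (deg e x + d.+1 * e y x).
  apply: leq_sum => x _; have := dmin x.
  case: eqVneq => [->|_]; first by rewrite e_irr; lia.
  by case: (e y x) => /=; rewrite ?muln1 ?mul1n ?muln0 ?mul0n; lia.
have cardN : \sum_x (x != y) = #|T|.-1.
  have : \sum_x (x != y) + \sum_x (x == y) = #|T|.
    rewrite -big_split -sum1_card /=; apply: eq_bigr => x _.
    by case: (x == y).
  rewrite sum_eq1; lia.
rewrite !big_split /= -!big_distrr -big_distrl /= -degE sum_eq1 cardN.
rewrite mul1n mulSn; move: #|T|.-1 (d * deg e y) => N k; lia.
Qed.

Local Open Scope ring_scope.

Lemma eigenvalue_bound (R : realFieldType) (T : finType) (e : rel T)
    (mu : R) d :
  irreflexive e -> (forall x, (d < deg e x)%N) ->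
  eigenvalue (adjmx R e) mu -> 0 <= mu -> d%:R <= mu ->
  mu * (mu - d%:R) + (d.+1 * #|T|.-1)%:R <= (\sum_x deg e x)%:R.
Proof.
move=> e_irr dmin /eigenvalueP[v vA v0] mu0 dmu.
pose u x := `|v 0 (enum_rank x)|.
have u_ge0 x : 0 <= u x by exact: normr_ge0.
have uA x : mu * u x <= \sum_y u y * (e y x)%:R.
  have /matrixP/(_ 0 (enum_rank x)) := vA; rewrite !mxE => vAx.
  rewrite /u -{1}(ger0_norm mu0) -normrM -vAx.
  rewrite (reindex_onto enum_rank enum_val) /=; last first.
    by move=> i _; rewrite enum_valK.
  rewrite (eq_bigl xpredT) /=; last by move=> y; rewrite enum_rankK eqxx.
  apply: le_trans (ler_norm_sum _ _ _) _.
  by apply: ler_sum => y _; rewrite normrM !mxE !enum_rankK normr_nat.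
(* These are the pairings of [u] with the all-ones vector and with [A 1]; [t] is also the sum of the
   entries of [A u]. *)
pose s := \sum_x u x; pose t := \sum_x u x * (deg e x)%:R.
have s_gt0 : 0 < s.
  rewrite lt_def sumr_ge0 // andbT; apply: contra v0 => /eqP s0.
  apply/eqP/rowP => i; rewrite mxE -(enum_valK i).
  apply/eqP; rewrite -normr_eq0.
  have /psumr_eq0P u0 : forall x, true -> 0 <= u x by [].
  by rewrite -[`|_|]/(u (enum_val i)) u0.
have le_st : mu * s <= t.
  rewrite /s mulr_sumr; apply: le_trans (ler_sum _ (fun x _ => uA x)) _.
  rewrite exchange_big /= le_eqVlt; apply/orP; left; apply/eqP.
  by apply: eq_bigr => y _; rewrite -mulr_sumr degE natr_sum.
set c : R := (\sum_x deg e x)%:R - (d.+1 * #|T|.-1)%:R.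
(* Pair [mu u <= A u] with [A 1], move [A] across by the exchange of sums, and bound [A^2 1]
   entrywise. *)
have le_tt : mu * t <= c * s + d%:R * t.
  have le1 : mu * t <= \sum_x (\sum_y u y * (e y x)%:R) * (deg e x)%:R.
    rewrite /t mulr_sumr; apply: ler_sum => x _.
    by rewrite mulrA ler_wpM2r // uA.
  apply: (le_trans le1).
  under eq_bigr do rewrite mulr_suml.
  rewrite exchange_big /= /s /t !mulr_sumr -big_split /=.
  apply: ler_sum => y _.
  under eq_bigr do rewrite -mulrA -natrM.
  rewrite -mulr_sumr -natr_sum.
  rewrite [c * _]mulrC mulrCA -mulrDr ler_wpM2l // /c.
  have := neighbor_degree_sum T e d y e_irr dmin.
  rewrite -(ler_nat R) !natrD (natrM R d (deg e y)).
  lra.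
have : (mu * (mu - d%:R)) * s <= c * s.
  have : (mu - d%:R) * (mu * s) <= (mu - d%:R) * t.
    by rewrite ler_wpM2l // subr_ge0.
  lra.
rewrite ler_pM2r // /c => h; lra.
Qed.

Lemma degree_sum_ge (R : realFieldType) (n : nat) (mu : R) (D : nat) :
  (5 <= n)%N -> 0 <= mu -> n%:R ^+ 2 - 6 * n%:R + 15 <= mu ^+ 2 ->
  mu * (mu - 1) + (2 * n.-1)%:R <= D%:R ->
  (n ^ 2 + 15 <= D + 5 * n)%N /\ ((7 <= n)%N -> (n ^ 2 + 16 <= D + 5 * n)%N).
Proof.
move=> n5 mu0 mu2 muD.
have nE : (2 * n.-1)%:R = 2 * n%:R - 2 :> R.
  by rewrite natrM -subn1 natrB ?(leq_trans _ n5) // mulrBr mulr1.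
rewrite {}nE in muD.
have t2 : 5 <= n%:R :> R by rewrite (ler_nat R 5).
split=> [|n7]; rewrite leqNgt; apply/negP.
  rewrite addnS ltnS -(ler_nat R) (natrD _ D) (natrD _ (n ^ 2)) (natrM _ 5).
  rewrite natrX => lt.
  (* Substituting the lower bound on [mu ^+ 2] into [muD] and [lt] leaves [mu >= n - 1]; then
     [mu (mu - 1) + 2 n - 2] is at least [n^2 - n], above [n^2 - 5 n + 14]. *)
  have : 2 <= mu - (n%:R - 3) by nra.
  nra.
have t4 : 7 <= n%:R :> R by rewrite (ler_nat R 7).
rewrite addnS ltnS -(ler_nat R) (natrD _ D) (natrD _ (n ^ 2)) (natrM _ 5).
rewrite natrX => lt.
have : 1 <= mu - (n%:R - 3) by nra.
nra.
Qed.

Lemma degree_sum_ge3 (R : realFieldType) (n : nat) (mu : R) (D : nat) :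
  (7 <= n)%N -> 0 <= mu -> n%:R ^+ 2 - 6 * n%:R + 15 <= mu ^+ 2 ->
  mu * (mu - 2) + (3 * n.-1)%:R <= D%:R -> (n ^ 2 + 17 <= D + 5 * n)%N.
Proof.
move=> n7 mu0 mu2 muD.
have nE : (3 * n.-1)%:R = 3 * n%:R - 3 :> R.
  by rewrite natrM -subn1 natrB ?(leq_trans _ n7) // mulrBr mulr1.
rewrite {}nE in muD.
have t4 : 7 <= n%:R :> R by rewrite (ler_nat R 7).
rewrite leqNgt; apply/negP.
rewrite addnS ltnS -(ler_nat R) (natrD _ D) (natrD _ (n ^ 2)) (natrM _ 5).
rewrite natrX => lt.
(* Likewise [mu >= n - 2], so [D >= n^2 - 3 n + 5], which exceeds [n^2 - 5 n + 16] once [n >= 6]. *)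
have : 1 <= mu - (n%:R - 3) by nra.
nra.
Qed.

(** * Assembling the spectral and combinatorial bounds *)

Lemma min_degree_le (T : finType) (e : rel T) x : (min_degree e <= deg e x)%N.
Proof.
rewrite /min_degree; have := mem_index_enum x.
elim: (index_enum T) => // y s IHs; rewrite inE big_cons.
case/predU1P=> [<-|/IHs]; first exact: geq_minl.
exact/leq_trans/geq_minr.
Qed.

Theorem theorem3p2 (R : realType) (T : finType) (e : rel T)
    (e_sym : symmetric e) (e_irr : irreflexive e)
    (e_conn : connected_graph e)
    (n_ge5 : (5 <= #|T|)%N)
    (delta_ge2 : (2 <= min_degree e)%N)
    (mu : R) (mu_radius : is_spectral_radius e mu)
    (mu_ge : Num.sqrt (#|T|%:R ^+ 2 - 6 * #|T|%:R + 15) <= mu) :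
  ~ bipartite e -> pancyclic e.
Proof.
move=> _; have [mu_eig _] := mu_radius.
have d2 x : (1 < deg e x)%N := leq_trans delta_ge2 (min_degree_le T e x).
have mu0 : 0 <= mu := le_trans (sqrtr_ge0 _) mu_ge.
have n5 : 5 <= #|T|%:R :> R by rewrite (ler_nat R 5).
have mu2 : #|T|%:R ^+ 2 - 6 * #|T|%:R + 15 <= mu ^+ 2.
  by rewrite -ler_sqrt ?sqr_ge0 // sqrtr_sqr ger0_norm.
(* The eigenvalue bound needs [d <= mu] for [d = 1] and [d = 2]; the radicand is at least 10 when
   [n >= 5]. *)
have mu_ge2 : 2 <= mu by nra.
have bnd := eigenvalue_bound R T e mu _ e_irr _ mu_eig mu0.
have [h15 h16] : (#|T| ^ 2 + 15 <= \sum_x deg e x + 5 * #|T|)%N /\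
    ((7 <= #|T|)%N -> (#|T| ^ 2 + 16 <= \sum_x deg e x + 5 * #|T|)%N).
  apply: (degree_sum_ge R _ mu) => //; apply: bnd d2 _; lra.
(* Density comes from [2 (n^2 - 5 n + 15) - n^2 = (n - 5)^2 + 5 > 0]. *)
apply: hamiltonian_pancyclic => //; first by nia.
apply: dense_hamiltonian => // n7 d3.
by apply: (degree_sum_ge3 R _ mu) => //; apply: bnd d3 _.
Qed.
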